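(* If every finitely generated graded $A$-module is noetherian, then every finitely generated graded $A$-module is centrally stable.
   Context: $R$ is a commutative ring and $\mathbb{Z}_+$ is the set of non-negative integers. $\mathcal{A}$ is an $R$-linear category (a category enriched over $R$-modules) with $\operatorname{Ob}(\mathcal{A})=\mathbb{Z}_+$ and $\operatorname{Hom}_{\mathcal{A}}(m,n)=0$ whenever $m>n$. Its category algebra is the (non-unital) $R$-algebra $A=\bigoplus_{m,n\in\mathbb{Z}_+}\operatorname{Hom}_{\mathcal{A}}(m,n)$, with product given by composition (and zero when morphisms are not composable). For $n\in\mathbb{Z}_+$, $e_n\in A$ is the identity endomorphism of $n$; for $m\leqslant n$, $e_{m,n}:=e_m+e_{m+1}+\cdots+e_n$. A graded $A$-module is an $A$-module $V$ with $V=\bigoplus_{n\in\mathbb{Z}_+}e_nV$ (every $A$-submodule of a graded $A$-module is then graded). It is finitely generated if it is finitely generated as an $A$-module; equivalently, for some $N\in\mathbb{Z}_+$ there is an exact sequence $\bigoplus_{i\in I}Ae_{0,N}\to V\to 0$ with $I$ finite. It is noetherian if every $A$-submodule of $V$ is finitely generated. It is centrally stable if for all $N$ sufficiently large one has $Ae\otimes_{eAe}eV\cong V$ (as $A$-modules), where $e=e_{0,N}$. *)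

(* Defs.v *)
From HB Require Import structures.
From mathcomp Require Import all_boot all_order all_algebra.
From mathcomp Require Import all_classical.

Set Implicit Arguments.
Unset Strict Implicit.
Unset Printing Implicit Defensive.
Import GRing.Theory.
Local Open Scope classical_set_scope.
Local Open Scope ring_scope.
Local Open Scope quotient_scope.

(* Objects are the natural numbers, [lc_comp g f] is g after f, and
   [lc_directed] is part of the structure. *)
Record lincat (R : comPzRingType) := LinCat {
  lc_hom : nat -> nat -> lmodType R;
  lc_id : forall n, lc_hom n n;
  lc_comp : forall m n k, lc_hom n k -> lc_hom m n -> lc_hom m k;
  lc_compDl : forall m n k (g h : lc_hom n k) (f : lc_hom m n),
    lc_comp (g + h) f = lc_comp g f + lc_comp h f;
  lc_compDr : forall m n k (g : lc_hom n k) (f h : lc_hom m n),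
    lc_comp g (f + h) = lc_comp g f + lc_comp g h;
  lc_compZl : forall m n k r (g : lc_hom n k) (f : lc_hom m n),
    lc_comp (r *: g) f = r *: lc_comp g f;
  lc_compZr : forall m n k r (g : lc_hom n k) (f : lc_hom m n),
    lc_comp g (r *: f) = r *: lc_comp g f;
  lc_compA : forall m n k l (h : lc_hom k l) (g : lc_hom n k) (f : lc_hom m n),
    lc_comp h (lc_comp g f) = lc_comp (lc_comp h g) f;
  lc_comp1l : forall m n (f : lc_hom m n), lc_comp (lc_id n) f = f;
  lc_comp1r : forall m n (f : lc_hom m n), lc_comp f (lc_id m) = f;
  lc_directed : forall m n (f : lc_hom m n), (n < m)%N -> f = 0 }.

Section CategoryAlgebra.
Variables (R : comPzRingType) (C : lincat R).
Implicit Types (m n k : nat).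

(* Finitely supported families (a m n) with a m n in Hom(m, n). *)
Record catalg := CatAlg {
  ca_coef :> forall m n, lc_hom C m n;
  ca_finite : finite_set [set p : nat * nat | ca_coef p.1 p.2 != 0] }.

Lemma catalgP (a b : catalg) : (forall m n, a m n = b m n) -> a = b.
Proof.
case: a b => [a fa] [b fb] /= eqab.
have e : a = b by apply: functional_extensionality_dep => m;
  apply: functional_extensionality_dep => n.
by subst b; congr CatAlg; exact: Prop_irrelevance.
Qed.

HB.instance Definition _ := gen_eqMixin catalg.
HB.instance Definition _ := gen_choiceMixin catalg.

Lemma compC0l m n k (f : lc_hom C m n) :
  lc_comp (0 : lc_hom C n k) f = 0.
Proof. by rewrite -(scale0r 0) lc_compZl scale0r. Qed.

Lemma compC0r m n k (g : lc_hom C n k) :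
  lc_comp g (0 : lc_hom C m n) = 0.
Proof. by rewrite -(scale0r 0) lc_compZr scale0r. Qed.

Lemma compC_suml m n k I (r : seq I) (P : pred I) (F : I -> lc_hom C n k)
    (f : lc_hom C m n) :
  lc_comp (\sum_(i <- r | P i) F i) f = \sum_(i <- r | P i) lc_comp (F i) f.
Proof.
by elim/big_rec2: _ => [|i x y _ <-]; rewrite ?compC0l ?lc_compDl.
Qed.

Lemma compC_sumr m n k I (r : seq I) (P : pred I) (F : I -> lc_hom C m n)
    (g : lc_hom C n k) :
  lc_comp g (\sum_(i <- r | P i) F i) = \sum_(i <- r | P i) lc_comp g (F i).
Proof.
by elim/big_rec2: _ => [|i x y _ <-]; rewrite ?compC0r ?lc_compDr.
Qed.

Fact ca0_finite :
  finite_set [set p : nat * nat | (0 : lc_hom C p.1 p.2) != 0].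
Proof.
by apply: (sub_finite_set _ (finite_set0 _)) => p /=; rewrite eqxx.
Qed.
Definition ca0 := @CatAlg (fun m n => 0) ca0_finite.

Fact caD_finite (a b : catalg) :
  finite_set [set p : nat * nat | a p.1 p.2 + b p.1 p.2 != 0].
Proof.
have := ca_finite b; have := ca_finite a => fa fb.
apply: (@sub_finite_set _ _ ([set p : nat * nat | a p.1 p.2 != 0] `|`
  [set p : nat * nat | b p.1 p.2 != 0])); last by rewrite finite_setU.
move=> p /=; case: (eqVneq (a p.1 p.2) 0) => [->|]; last by left.
by rewrite add0r; right.
Qed.
Definition caD (a b : catalg) :=
  @CatAlg (fun m n => a m n + b m n) (caD_finite a b).

Fact caZ_finite r (a : catalg) :
  finite_set [set p : nat * nat | r *: a p.1 p.2 != 0].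
Proof.
apply: sub_finite_set (ca_finite a) => p /=.
by apply: contra_neq => ->; rewrite scaler0.
Qed.
Definition caZ r (a : catalg) :=
  @CatAlg (fun m n => r *: a m n) (caZ_finite r a).

Fact caDA : associative caD.
Proof. by move=> a b c; apply: catalgP => m n /=; rewrite addrA. Qed.
Fact caDC : commutative caD.
Proof. by move=> a b; apply: catalgP => m n /=; rewrite addrC. Qed.
Fact ca0D : left_id ca0 caD.
Proof. by move=> a; apply: catalgP => m n /=; rewrite add0r. Qed.
Fact caND : left_inverse ca0 (caZ (-1)) caD.
Proof. by move=> a; apply: catalgP => m n /=; rewrite scaleN1r addNr. Qed.

HB.instance Definition _ := GRing.isZmodule.Build catalg caDA caDC ca0D caND.

Fact caZA r s (a : catalg) : caZ r (caZ s a) = caZ (r * s) a.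
Proof. by apply: catalgP => m n /=; rewrite scalerA. Qed.
Fact ca1Z : left_id 1 caZ.
Proof. by move=> a; apply: catalgP => m n /=; rewrite scale1r. Qed.
Fact caZDr : right_distributive caZ +%R.
Proof. by move=> r a b; apply: catalgP => m n /=; rewrite scalerDr. Qed.
Fact caZDl (a : catalg) : {morph caZ^~ a : r s / r + s}.
Proof. by move=> r s; apply: catalgP => m n /=; rewrite scalerDl. Qed.

HB.instance Definition _ :=
  GRing.Zmodule_isLmodule.Build R catalg caZA ca1Z caZDr caZDl.

(* Since Hom(k, n) = 0 for n < k, the sum over k <= n is the sum over all k. *)
Definition cam_coef (a b : catalg) m n : lc_hom C m n :=
  \sum_(k < n.+1) lc_comp (a k n) (b m k).

Fact cam_finite (a b : catalg) :
  finite_set [set p : nat * nat | cam_coef a b p.1 p.2 != 0].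
Proof.
have fab := finite_setX (ca_finite a) (ca_finite b).
apply: sub_finite_set
  (finite_image (fun q : (nat * nat) * (nat * nat) => (q.2.1, q.1.2)) fab).
move=> [m n] /= nz.
have [k nzk] : exists k : 'I_n.+1, lc_comp (a k n) (b m k) != 0.
  apply: contrapT => /forallNP z; move/eqP: nz; apply.
  by rewrite /cam_coef big1 // => k _; have /negP := z k; rewrite negbK => /eqP.
exists ((k : nat, n), (m, k : nat)) => //=; split => /=.
  by apply: contra_neq nzk => ->; rewrite compC0l.
by apply: contra_neq nzk => ->; rewrite compC0r.
Qed.
Definition cam (a b : catalg) := @CatAlg (cam_coef a b) (cam_finite a b).

Lemma cam_coefE (a b : catalg) m n N : (n < N)%N ->
  cam a b m n = \sum_(k < N) lc_comp (a k n) (b m k).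
Proof.
move=> ltnN; rewrite /= /cam_coef.
rewrite (big_ord_widen N (fun k => lc_comp (a k n) (b m k))) // big_mkcond /=.
apply: eq_bigr => k _; case: ltnP => // ltnk.
by rewrite (lc_directed (a k n) ltnk) compC0l.
Qed.

Lemma camA : associative cam.
Proof.
move=> a b c; apply: catalgP => m n /=; rewrite /cam_coef.
under eq_bigr => k _ do rewrite (@cam_coefE b c m k n.+1) // compC_sumr.
under [RHS]eq_bigr => k _ do rewrite compC_suml.
rewrite exchange_big /=; apply: eq_bigr => k _; apply: eq_bigr => l _.
exact: lc_compA.
Qed.

Lemma camDl : left_distributive cam +%R.
Proof.
move=> a b c; apply: catalgP => m n /=; rewrite /cam_coef -big_split /=.
by apply: eq_bigr => k _; rewrite lc_compDl.
Qed.

Lemma camDr : right_distributive cam +%R.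
Proof.
move=> a b c; apply: catalgP => m n /=; rewrite /cam_coef -big_split /=.
by apply: eq_bigr => k _; rewrite lc_compDr.
Qed.

Lemma camZl r a b : cam (r *: a) b = r *: cam a b.
Proof.
apply: catalgP => m n /=; rewrite /cam_coef scaler_sumr.
by apply: eq_bigr => k _; rewrite lc_compZl.
Qed.

Lemma camZr r a b : cam a (r *: b) = r *: cam a b.
Proof.
apply: catalgP => m n /=; rewrite /cam_coef scaler_sumr.
by apply: eq_bigr => k _; rewrite lc_compZr.
Qed.

Lemma cam0l a : cam 0 a = 0.
Proof. by have := camZl 0 0 a; rewrite !scale0r. Qed.
Lemma cam0r a : cam a 0 = 0.
Proof. by have := camZr 0 a 0; rewrite !scale0r. Qed.
Lemma camBl a b c : cam (a - b) c = cam a c - cam b c.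
Proof. by rewrite -!scaleN1r camDl camZl. Qed.
Lemma camBr a b c : cam c (a - b) = cam c a - cam c b.
Proof. by rewrite -!scaleN1r camDr camZr. Qed.

(* The identity of i in position (i, i), transported along m = i and n = i. *)
Definition hom_at i m n : lc_hom C m n :=
  if m =P i is ReflectT mi then
    if n =P i is ReflectT ni then
      ecast z (lc_hom C m z) (esym ni) (ecast z (lc_hom C z i) (esym mi)
        (lc_id C i))
    else 0
  else 0.

Fact hom_at_finite i : finite_set [set p : nat * nat | hom_at i p.1 p.2 != 0].
Proof.
apply: (sub_finite_set _ (finite_set1 (i, i))) => -[m n] /=; rewrite /hom_at.
case: eqP => [mi|_]; last by rewrite eqxx.
by case: eqP => [ni|_]; [move=> _; congr pair|rewrite eqxx].
Qed.

Definition ce i : catalg := @CatAlg (hom_at i) (hom_at_finite i).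

Lemma ce_diag i : ce i i i = lc_id C i.
Proof.
rewrite /= /hom_at; case: (i =P i) => // e1.
by rewrite (eq_irrelevance e1 erefl).
Qed.

Lemma ce_off i m n : (m, n) != (i, i) -> ce i m n = 0.
Proof.
rewrite xpair_eqE /= /hom_at; case: (m =P i) => //= mi.
by case: (n =P i).
Qed.

Lemma ca0E m n : (0 : catalg) m n = 0. Proof. by []. Qed.

Lemma ceM i j : cam (ce i) (ce j) = if i == j then ce i else 0.
Proof.
apply: catalgP => m n; rewrite (@cam_coefE _ _ m n (maxn n i).+1) ?ltnS ?leq_maxl //.
have lti : (i < (maxn n i).+1)%N by rewrite ltnS leq_maxr.
rewrite (bigD1 (Ordinal lti)) // big1 ?Monoid.mulm1; last first.
  move=> k; rewrite -val_eqE => nk.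
  by rewrite (@ce_off i) ?compC0l // xpair_eqE (negPf nk).
rewrite [nat_of_ord _]/=; case: (eqVneq i j) => [<-|nij]; last first.
  by rewrite (@ce_off j) ?compC0r ?ca0E // xpair_eqE (negPf nij) andbF.
case: (eqVneq n i) => [->|nn]; first by rewrite (ce_diag i) lc_comp1l.
by rewrite !(@ce_off i _ n) ?compC0l // xpair_eqE (negPf nn) andbF.
Qed.

Definition ces m n : catalg := \sum_(m <= i < n.+1) ce i.

Lemma cam_sumr a I (r : seq I) (P : pred I) F :
  cam a (\sum_(i <- r | P i) F i) = \sum_(i <- r | P i) cam a (F i).
Proof. by elim/big_rec2: _ => [|i x y _ <-]; rewrite ?cam0r ?camDr. Qed.

Lemma cam_suml a I (r : seq I) (P : pred I) F :
  cam (\sum_(i <- r | P i) F i) a = \sum_(i <- r | P i) cam (F i) a.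
Proof. by elim/big_rec2: _ => [|i x y _ <-]; rewrite ?cam0l ?camDl. Qed.

Lemma ces_idem m n : cam (ces m n) (ces m n) = ces m n.
Proof.
rewrite {1}/ces cam_suml; apply: eq_big_seq => i; rewrite mem_index_iota => mi.
rewrite /ces cam_sumr (bigD1_seq i) ?iota_uniq ?mem_index_iota //=.
rewrite ceM eqxx big1 ?addr0 // => j nj.
by rewrite ceM eq_sym (negPf nj).
Qed.

End CategoryAlgebra.

Arguments ce {R} C i.
Arguments ces {R} C m n.

(* Modules over the category algebra, which has no unit in general; no unit
   condition is imposed. *)
Record amod (R : comPzRingType) (C : lincat R) := AMod {
  am_car :> lmodType R;
  am_act : catalg C -> am_car -> am_car;
  am_actDl : forall a b v, am_act (a + b) v = am_act a v + am_act b v;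
  am_actDr : forall a u v, am_act a (u + v) = am_act a u + am_act a v;
  am_actZl : forall r a v, am_act (r *: a) v = r *: am_act a v;
  am_actZr : forall r a v, am_act a (r *: v) = r *: am_act a v;
  am_actA : forall a b v, am_act a (am_act b v) = am_act (cam a b) v }.

Section ModuleNotions.
Variables (R : comPzRingType) (C : lincat R).
Implicit Types (V W : amod C).

Definition amod_graded V : Prop := forall v : V,
  exists! w : nat -> V,
    [/\ forall n, range (fun v : V => am_act (ce C n) v) (w n),
        finite_set [set n | w n != 0]
      & v = \sum_(n \in [set: nat]) w n].

Record amod_submodule V (S : set V) : Prop := AModSubmodule {
  ams_0 : S 0;
  ams_D : forall u v, S u -> S v -> S (u + v);
  ams_Z : forall r v, S v -> S (r *: v);
  ams_act : forall a v, S v -> S (am_act a v) }.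

Definition amod_fg_submodule V (S : set V) : Prop :=
  exists s : seq V, S = smallest (@amod_submodule V) [set` s].

Definition amod_fg V : Prop := amod_fg_submodule [set: V].

Definition amod_noetherian V : Prop :=
  forall S : set V, amod_submodule S -> amod_fg_submodule S.

Definition amod_iso V W : Prop :=
  exists f : {linear V -> W},
    bijective f /\ forall a v, f (am_act a v) = am_act a (f v).

End ModuleNotions.

(* The tensor product of a right B-module M (a left module over the converse
   ring B^c) and a left B-module L over a not necessarily commutative ring B:
   finite formal sums of pairs, modulo the congruence making the pairing
   additive in each variable and B-balanced.  Opposites need no formal
   counterpart, since - (x (x) v) = (- x) (x) v. *)
Section TensorProduct.
Variables (B : pzRingType) (M : lmodType B^c) (L : lmodType B).

Inductive tensor_rel : seq (M * L) -> seq (M * L) -> Prop :=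
| TRrefl s : tensor_rel s s
| TRsym s t : tensor_rel s t -> tensor_rel t s
| TRtrans s t u : tensor_rel s t -> tensor_rel t u -> tensor_rel s u
| TRcat s s' t t' :
    tensor_rel s s' -> tensor_rel t t' -> tensor_rel (s ++ t) (s' ++ t')
| TRcatC s t : tensor_rel (s ++ t) (t ++ s)
| TR0l v : tensor_rel [:: (0, v)] [::]
| TR0r x : tensor_rel [:: (x, 0)] [::]
| TRDl x y v : tensor_rel [:: (x + y, v)] [:: (x, v); (y, v)]
| TRDr x u v : tensor_rel [:: (x, u + v)] [:: (x, u); (x, v)]
| TRbal (b : B) x v : tensor_rel [:: ((b : B^c) *: x, v)] [:: (x, b *: v)].

Definition tensor_eq : rel (seq (M * L)) := fun s t => `[< tensor_rel s t >].

Fact tensor_eq_equiv : equiv_class_of tensor_eq.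
Proof.
split=> [s|s t|t s u].
- by apply/asboolP; exact: TRrefl.
- by apply/asboolP/asboolP => /TRsym.
- by move=> /asboolP st /asboolP tu; apply/asboolP; exact: TRtrans tu.
Qed.
Canonical tensor_equiv := EquivRelPack tensor_eq_equiv.

Definition tensor := {eq_quot tensor_equiv}.
HB.instance Definition _ := Choice.on tensor.
HB.instance Definition _ := EqQuotient.on tensor.

Lemma tensorP s t : reflect (tensor_rel s t) (\pi_tensor s == \pi_tensor t).
Proof. by rewrite eqmodE; exact: asboolP. Qed.

Lemma tensor_piE s t : tensor_rel s t -> \pi_tensor s = \pi_tensor t.
Proof. by move=> st; apply/eqP/tensorP. Qed.

Lemma tensor_reprP s : tensor_rel (repr (\pi_tensor s)) s.
Proof. by apply/tensorP; rewrite reprK. Qed.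

Definition tadd (s t : tensor) : tensor := \pi_tensor (repr s ++ repr t).
Definition topp (s : tensor) : tensor :=
  \pi_tensor [seq (- p.1, p.2) | p <- repr s].

Lemma tadd_pi s t : tadd (\pi_tensor s) (\pi_tensor t) = \pi_tensor (s ++ t).
Proof. by apply: tensor_piE; apply: TRcat; exact: tensor_reprP. Qed.

Fact taddA : associative tadd.
Proof.
move=> s t u; rewrite -[s]reprK -[t]reprK -[u]reprK.
rewrite (tadd_pi (repr t) (repr u)) (tadd_pi (repr s) (repr t)).
by rewrite (tadd_pi (repr s)) (tadd_pi (_ ++ _)) catA.
Qed.
Fact taddC : commutative tadd.
Proof. by move=> s t; apply: tensor_piE; exact: TRcatC. Qed.
Fact tadd0 : left_id (\pi_tensor [::]) tadd.
Proof. by move=> s; rewrite -[s]reprK tadd_pi. Qed.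
Fact taddN : left_inverse (\pi_tensor [::]) topp tadd.
Proof.
move=> s; rewrite -[in RHS](cats0 [::]) -[s in tadd _ s]reprK tadd_pi.
apply: tensor_piE; elim: (repr s) => [|[x v] r IHr] /=; first exact: TRrefl.
apply: (@TRtrans _ (([:: (- x, v)] ++ [:: (x, v)]) ++
                    ([seq (- p.1, p.2) | p <- r] ++ r))).
  rewrite -catA; apply: (@TRcat [:: (- x, v)] [:: (- x, v)]); first exact: TRrefl.
  rewrite catA -(cat1s _ r) catA; apply: TRcat; last exact: TRrefl.
  exact: TRcatC.
rewrite -[X in tensor_rel _ X]cats0; apply: TRcat => //.
apply: TRtrans (TR0l v); rewrite -(addNr x); apply: TRsym; exact: TRDl.
Qed.

HB.instance Definition _ := GRing.isZmodule.Build tensor taddA taddC tadd0 taddN.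

Definition tpure (x : M) (v : L) : tensor := \pi_tensor [:: (x, v)].

Lemma tpureDl x y v : tpure (x + y) v = tpure x v + tpure y v.
Proof. by rewrite [RHS]tadd_pi; apply: tensor_piE; exact: TRDl. Qed.
Lemma tpureDr x u v : tpure x (u + v) = tpure x u + tpure x v.
Proof. by rewrite [RHS]tadd_pi; apply: tensor_piE; exact: TRDr. Qed.
Lemma tpure_bal (b : B) x v : tpure ((b : B^c) *: x) v = tpure x (b *: v).
Proof. by apply: tensor_piE; exact: TRbal. Qed.

Lemma tensor_piE_sum s : \pi_tensor s = \sum_(p <- s) tpure p.1 p.2.
Proof.
elim: s => [|[x v] s IHs]; first by rewrite big_nil.
by rewrite big_cons -IHs /= [RHS]tadd_pi.
Qed.

Lemma tensor_sum (t : tensor) :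
  exists s : seq (M * L), t = \sum_(p <- s) tpure p.1 p.2.
Proof. by exists (repr t); rewrite -tensor_piE_sum reprK. Qed.

Lemma tensor_rel_sum (G : zmodType) (f : M -> L -> G) s t :
    (forall x y v, f (x + y) v = f x v + f y v) ->
    (forall x u v, f x (u + v) = f x u + f x v) ->
    (forall (b : B) x v, f ((b : B^c) *: x) v = f x (b *: v)) ->
  tensor_rel s t -> \sum_(p <- s) f p.1 p.2 = \sum_(p <- t) f p.1 p.2.
Proof.
move=> fDl fDr fbal.
elim=> {s t} [//|s t _ ->//|s t u _ -> _ ->//| s s' t t' _ IH1 _ IH2|s t|v|x|
  x y v|x u v|b x v]; rewrite ?big_cat ?big_cons ?big_nil ?addr0 /=.
- by rewrite IH1 IH2.
- by rewrite addrC.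
- by apply: (addrI (f 0 v)); rewrite -fDl !addr0.
- by apply: (addrI (f x 0)); rewrite -fDr !addr0.
- exact: fDl.
- exact: fDr.
- exact: fbal.
Qed.

Theorem tensor_universal (G : zmodType) (f : M -> L -> G) :
    (forall x y v, f (x + y) v = f x v + f y v) ->
    (forall x u v, f x (u + v) = f x u + f x v) ->
    (forall (b : B) x v, f ((b : B^c) *: x) v = f x (b *: v)) ->
  exists! g : tensor -> G,
    {morph g : s t / s + t} /\ forall x v, g (tpure x v) = f x v.
Proof.
move=> fDl fDr fbal.
have relS := tensor_rel_sum fDl fDr fbal.
exists (fun t => \sum_(p <- repr t) f p.1 p.2); split; first split.
- move=> s t; rewrite -big_cat; apply: relS; exact: tensor_reprP.
- by move=> x v; rewrite (relS _ _ (tensor_reprP _)) big_seq1.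
move=> g [gD gP]; apply: funext => t.
rewrite -[t in RHS]reprK tensor_piE_sum.
elim/big_rec2: _ => [|p y1 y2 _ ->]; last by rewrite gD gP.
by apply: (addrI (g 0)); rewrite -gD !addr0.
Qed.

End TensorProduct.

Section TensorMap.
Variables (B : pzRingType) (M : lmodType B^c) (L : lmodType B).

Definition tmap (f : M -> M) (t : tensor M L) : tensor M L :=
  \sum_(p <- repr t) tpure (f p.1) p.2.

Variable f : M -> M.
Hypothesis fD : {morph f : x y / x + y}.
Hypothesis fZ : forall (b : B^c) x, f (b *: x) = b *: f x.

Lemma tmap_pi s : tmap f (\pi_(tensor M L) s) = \sum_(p <- s) tpure (f p.1) p.2.
Proof.
apply: (@tensor_rel_sum _ _ _ _ (fun x v => tpure (f x) v)) (tensor_reprP _).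
- by move=> x y v; rewrite fD tpureDl.
- by move=> x u v; rewrite tpureDr.
- by move=> b x v; rewrite fZ tpure_bal.
Qed.

Lemma tmapD : {morph tmap f : s t / s + t}.
Proof.
move=> s t; rewrite -[s]reprK -[t]reprK [X in tmap f X]tadd_pi !tmap_pi.
by rewrite big_cat.
Qed.

Lemma tmap_pure x v : tmap f (tpure x v) = tpure (f x) v.
Proof. by rewrite tmap_pi big_seq1. Qed.
End TensorMap.

Lemma tensor_ext (B : pzRingType) (M : lmodType B^c) (L : lmodType B)
    (G : zmodType) (g h : tensor M L -> G) :
    {morph g : s t / s + t} -> {morph h : s t / s + t} ->
    (forall x v, g (tpure x v) = h (tpure x v)) -> forall t, g t = h t.
Proof.
move=> gD hD gh t; have [s ->] := tensor_sum t.
elim: s => [|p s IHs]; last by rewrite big_cons gD hD IHs gh.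
rewrite big_nil; transitivity (0 : G); last apply: esym.
  by apply: (addrI (g 0)); rewrite -gD !addr0.
by apply: (addrI (h 0)); rewrite -hD !addr0.
Qed.

Section Corner.
Variables (R : comPzRingType) (C : lincat R) (N : nat).
Local Notation A := (catalg C).
Local Notation e := (ces C 0 N).
Local Notation "a ** b" := (cam a b) (at level 40, left associativity).

Definition corner_pred : {pred A} := fun x => `[< exists a, x = e ** a ** e >].

Lemma corner_predP x :
  reflect (e ** x = x /\ x ** e = x) (x \in corner_pred).
Proof.
apply: (iffP (asboolP _)) => [[a ->]|[ex xe]]; last by exists x; rewrite ex xe.
by rewrite !camA ces_idem -!camA ces_idem.
Qed.

Fact corner_zmod : zmod_closed corner_pred.
Proof.
split=> [|x y /corner_predP[ex xe] /corner_predP[ey ye]]; apply/corner_predP.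
  by rewrite cam0l cam0r.
by rewrite camBl camBr ex ey xe ye.
Qed.
HB.instance Definition _ := GRing.isZmodClosed.Build A corner_pred corner_zmod.

(* The ring e A e, with unit e. *)
Record corner := Corner { corner_val : A; _ : corner_val \in corner_pred }.
HB.instance Definition _ := [isSub for corner_val].
HB.instance Definition _ := [Choice of corner by <:].
HB.instance Definition _ := [SubChoice_isSubZmodule of corner by <:].

Fact corner1_in : e \in corner_pred.
Proof. by apply/corner_predP; rewrite ces_idem. Qed.
Definition corner1 := Corner corner1_in.

Fact cornerM_in (x y : corner) : corner_val x ** corner_val y \in corner_pred.
Proof.
case: x y => [x /= /corner_predP[ex xe]] [y /= /corner_predP[ey ye]].
by apply/corner_predP; rewrite camA ex -camA ye.
Qed.
Definition cornerM x y := Corner (cornerM_in x y).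

Fact cornerMA : associative cornerM.
Proof. by move=> x y z; apply: val_inj; exact: camA. Qed.
Fact corner1M : left_id corner1 cornerM.
Proof. by case=> x px; apply: val_inj; have [] := corner_predP _ px. Qed.
Fact cornerM1 : right_id corner1 cornerM.
Proof. by case=> x px; apply: val_inj; have [] := corner_predP _ px. Qed.
Fact cornerMDl : left_distributive cornerM +%R.
Proof. by move=> x y z; apply: val_inj; exact: camDl. Qed.
Fact cornerMDr : right_distributive cornerM +%R.
Proof. by move=> x y z; apply: val_inj; exact: camDr. Qed.

HB.instance Definition _ := GRing.Zmodule_isPzRing.Build corner
  cornerMA corner1M cornerM1 cornerMDl cornerMDr.

Definition leftid_pred : {pred A} := fun x => `[< exists a, x = a ** e >].

Lemma leftid_predP x : reflect (x ** e = x) (x \in leftid_pred).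
Proof.
apply: (iffP (asboolP _)) => [[a ->]|xe]; last by exists x.
by rewrite -camA ces_idem.
Qed.

Fact leftid_zmod : zmod_closed leftid_pred.
Proof.
split=> [|x y /leftid_predP xe /leftid_predP ye]; apply/leftid_predP.
  by rewrite cam0l.
by rewrite camBl xe ye.
Qed.
HB.instance Definition _ := GRing.isZmodClosed.Build A leftid_pred leftid_zmod.

(* The left ideal A e, a right module over e A e. *)
Record leftid := LeftId { leftid_val : A; _ : leftid_val \in leftid_pred }.
HB.instance Definition _ := [isSub for leftid_val].
HB.instance Definition _ := [Choice of leftid by <:].
HB.instance Definition _ := [SubChoice_isSubZmodule of leftid by <:].

Fact leftidM_in (b : corner) (x : leftid) :
  leftid_val x ** corner_val b \in leftid_pred.
Proof.
case: b => b /= /corner_predP[_ be].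
by apply/leftid_predP; rewrite -camA be.
Qed.
Definition leftidM (b : corner^c) x := LeftId (leftidM_in b x).

Fact leftidMA (b c : corner^c) x : leftidM b (leftidM c x) = leftidM (b * c) x.
Proof. by apply: val_inj; rewrite /= -camA. Qed.
Fact leftid1M : left_id 1 leftidM.
Proof. by case=> x px; apply: val_inj => /=; apply/leftid_predP. Qed.
Fact leftidMDr : right_distributive leftidM +%R.
Proof. by move=> b x y; apply: val_inj; exact: camDl. Qed.
Fact leftidMDl x : {morph leftidM^~ x : b c / b + c}.
Proof. by move=> b c; apply: val_inj; exact: camDr. Qed.

HB.instance Definition _ := GRing.Zmodule_isLmodule.Build corner^c leftid
  leftidMA leftid1M leftidMDr leftidMDl.

Fact leftid_act_in a (x : leftid) : a ** leftid_val x \in leftid_pred.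
Proof. by case: x => x /= /leftid_predP xe; apply/leftid_predP; rewrite -camA xe. Qed.
Definition leftid_act a x := LeftId (leftid_act_in a x).

Fact leftid_scale_in r (x : leftid) : r *: leftid_val x \in leftid_pred.
Proof. by case: x => x /= /leftid_predP xe; apply/leftid_predP; rewrite camZl xe. Qed.
Definition leftid_scale r x := LeftId (leftid_scale_in r x).

Variable V : amod C.

Lemma am_act0r a : am_act a (0 : V) = 0.
Proof. by have := am_actZr 0 a (0 : V); rewrite !scale0r. Qed.
Lemma am_actBr a (u v : V) : am_act a (u - v) = am_act a u - am_act a v.
Proof. by rewrite -!scaleN1r am_actDr am_actZr. Qed.

Definition cornermod_pred : {pred V} := fun v => `[< exists u, v = am_act e u >].

Lemma cornermod_predP v : reflect (am_act e v = v) (v \in cornermod_pred).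
Proof.
apply: (iffP (asboolP _)) => [[u ->]|ev]; last by exists v.
by rewrite am_actA ces_idem.
Qed.

Fact cornermod_zmod : zmod_closed cornermod_pred.
Proof.
split=> [|u v /cornermod_predP eu /cornermod_predP ev]; apply/cornermod_predP.
  exact: am_act0r.
by rewrite am_actBr eu ev.
Qed.
HB.instance Definition _ :=
  GRing.isZmodClosed.Build V cornermod_pred cornermod_zmod.

(* The left e A e-module e V. *)
Record cornermod :=
  CornerMod { cornermod_val : V; _ : cornermod_val \in cornermod_pred }.
HB.instance Definition _ := [isSub for cornermod_val].
HB.instance Definition _ := [Choice of cornermod by <:].
HB.instance Definition _ := [SubChoice_isSubZmodule of cornermod by <:].

Fact cornermodZ_in (b : corner) (v : cornermod) :
  am_act (corner_val b) (cornermod_val v) \in cornermod_pred.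
Proof.
case: b => b /= /corner_predP[eb _].
by apply/cornermod_predP; rewrite am_actA eb.
Qed.
Definition cornermodZ b v := CornerMod (cornermodZ_in b v).

Fact cornermodZA b c v : cornermodZ b (cornermodZ c v) = cornermodZ (b * c) v.
Proof. by apply: val_inj; exact: am_actA. Qed.
Fact cornermod1Z : left_id 1 cornermodZ.
Proof. by case=> v pv; apply: val_inj => /=; apply/cornermod_predP. Qed.
Fact cornermodZDr : right_distributive cornermodZ +%R.
Proof. by move=> b u v; apply: val_inj; exact: am_actDr. Qed.
Fact cornermodZDl v : {morph cornermodZ^~ v : b c / b + c}.
Proof. by move=> b c; apply: val_inj; exact: am_actDl. Qed.

HB.instance Definition _ := GRing.Zmodule_isLmodule.Build corner cornermod
  cornermodZA cornermod1Z cornermodZDr cornermodZDl.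

(* A e (x)_(e A e) e V; scalars and the algebra act on the factor A e. *)
Definition central : Type := tensor leftid cornermod.
HB.instance Definition _ := GRing.Zmodule.on central.

Definition centralZ r : central -> central := tmap (leftid_scale r).
Definition central_act a : central -> central := tmap (leftid_act a).

Fact leftid_scaleD r : {morph leftid_scale r : x y / x + y}.
Proof. by move=> x y; apply: val_inj; exact: scalerDr. Qed.
Fact leftid_scaleZ r (b : corner^c) x :
  leftid_scale r (b *: x) = b *: leftid_scale r x.
Proof. by apply: val_inj; rewrite /= camZl. Qed.
Fact leftid_actD a : {morph leftid_act a : x y / x + y}.
Proof. by move=> x y; apply: val_inj; exact: camDr. Qed.
Fact leftid_actZ a (b : corner^c) x :
  leftid_act a (b *: x) = b *: leftid_act a x.
Proof. by apply: val_inj; exact: camA. Qed.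

Fact centralZDr : right_distributive centralZ +%R.
Proof. by move=> r; exact: tmapD (leftid_scaleD r) (leftid_scaleZ r). Qed.
Fact central_actDr a (s t : central) :
  central_act a (s + t) = central_act a s + central_act a t.
Proof. exact: (tmapD (leftid_actD a) (leftid_actZ a)). Qed.

Lemma centralZ_pure r x v :
  centralZ r (tpure x v : central) = (tpure (leftid_scale r x) v : central).
Proof. exact: (tmap_pure (leftid_scaleD r) (leftid_scaleZ r)). Qed.
Lemma central_act_pure a x v :
  central_act a (tpure x v : central) = (tpure (leftid_act a x) v : central).
Proof. exact: (tmap_pure (leftid_actD a) (leftid_actZ a)). Qed.

Lemma central_ext (g h : central -> central) :
    {morph g : s t / s + t} -> {morph h : s t / s + t} ->
    (forall x v, g (tpure x v) = h (tpure x v)) -> forall t, g t = h t.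
Proof. exact: tensor_ext. Qed.

Fact centralZA r s t : centralZ r (centralZ s t) = centralZ (r * s) t.
Proof.
move: t; apply: central_ext => [s' t|s' t|x v]; rewrite ?centralZDr //.
by rewrite !centralZ_pure; congr tpure; apply: val_inj; exact: scalerA.
Qed.
Fact central1Z : left_id 1 centralZ.
Proof.
apply: central_ext => [s t|s t|x v]; rewrite ?centralZDr //.
by rewrite centralZ_pure; congr tpure; apply: val_inj; exact: scale1r.
Qed.
Fact centralZDl t : {morph centralZ^~ t : r s / r + s}.
Proof.
move=> r s; move: t; apply: central_ext => [s' t|s' t|x v];
  rewrite ?centralZDr // 1?addrACA //.
rewrite !centralZ_pure -[RHS]tpureDl; congr tpure.
by apply: val_inj; exact: scalerDl.
Qed.

HB.instance Definition _ := GRing.Zmodule_isLmodule.Build R central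
  centralZA central1Z centralZDr centralZDl.

Fact central_actDl a b (t : central) :
  central_act (a + b) t = central_act a t + central_act b t.
Proof.
move: t; apply: central_ext => [s t|s t|x v];
  rewrite ?central_actDr // 1?addrACA //.
rewrite !central_act_pure -[RHS]tpureDl; congr tpure.
by apply: val_inj; exact: camDl.
Qed.
Fact central_actZl r a (t : central) :
  central_act (r *: a) t = r *: central_act a t.
Proof.
move: t; apply: central_ext => [s t|s t|x v];
  rewrite ?central_actDr ?scalerDr //.
rewrite !central_act_pure -[RHS]/(centralZ r _) centralZ_pure; congr tpure.
by apply: val_inj; exact: camZl.
Qed.
Fact central_actZr r a (t : central) :
  central_act a (r *: t) = r *: central_act a t.
Proof.
move: t; apply: central_ext => [s t|s t|x v];
  rewrite ?scalerDr ?central_actDr ?scalerDr //.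
rewrite central_act_pure -[RHS]/(centralZ r _) centralZ_pure.
rewrite -[r *: _]/(centralZ r _) centralZ_pure central_act_pure; congr tpure.
by apply: val_inj; exact: camZr.
Qed.
Fact central_actA a b (t : central) :
  central_act a (central_act b t) = central_act (a ** b) t.
Proof.
move: t; apply: central_ext => [s t|s t|x v]; rewrite ?central_actDr //.
rewrite !central_act_pure; congr tpure.
by apply: val_inj; exact: camA.
Qed.

Definition central_amod : amod C :=
  AMod central_actDl central_actDr central_actZl central_actZr central_actA.

End Corner.

Definition centrally_stable (R : comPzRingType) (C : lincat R) (V : amod C) :
    Prop :=
  exists N0, forall N, (N0 <= N)%N -> amod_iso (central_amod N V) V.

(* Main.v *)
(* The counit Ae (x)_(eAe) eV -> V is onto once V is generated by elements
   s_1, ..., s_k fixed by e = e_{0,N}.  For its kernel, let N0 be such that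
   e_{0,N0} fixes every s_i, let F = (A e_{0,N0})^k, and let
   K be the kernel of F -> V.  For N >= N0 every tensor has the form
   sum_i y_i (x) s_i with y in F, and the counit sends it to the image of y in
   V.  As F is noetherian, K is generated by finitely many r, all fixed by e for
   large N; then the entries r_i lie in eAe, so
   sum_i r_i (x) s_i = e (x) sum_i r_i s_i = 0, and hence
   sum_i y_i (x) s_i = 0 for every y in K. *)
Require Import Defs.
From HB Require Import structures.
From mathcomp Require Import all_boot all_order all_algebra.
From mathcomp Require Import all_classical.

Set Implicit Arguments.
Unset Strict Implicit.
Unset Printing Implicit Defensive.
Import GRing.Theory.
Local Open Scope classical_set_scope.
Local Open Scope ring_scope.

(** * The idempotents [ce i] and [ces 0 M] in the category algebra *)

Section Idempotents.
Variables (R : comPzRingType) (C : lincat R).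
Local Notation A := (catalg C).

Lemma ca_sumE I (r : seq I) (P : pred I) (F : I -> A) m n :
  (\sum_(i <- r | P i) F i) m n = \sum_(i <- r | P i) F i m n.
Proof. by elim/big_rec2: _ => [//|i x y _ <-]. Qed.

Lemma cam_ceE i (a : A) m n : cam (ce C i) a m n = if n == i then a m n else 0.
Proof.
rewrite (@cam_coefE _ _ _ _ m n n.+1) //; case: eqVneq => [<-|ni].
  rewrite (bigD1 ord_max) // big1 ?Monoid.mulm1.
    by rewrite [nat_of_ord _]/= (ce_diag C n) lc_comp1l.
  move=> k; rewrite -val_eqE => kn.
  by rewrite (@ce_off _ C n) ?compC0l // xpair_eqE (negPf kn).
rewrite big1 // => k _.
by rewrite (@ce_off _ C i) ?compC0l // xpair_eqE (negPf ni) andbF.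
Qed.

Lemma ces_ceE M i : cam (ces C 0 M) (ce C i) = if (i <= M)%N then ce C i else 0.
Proof.
rewrite cam_suml; under eq_bigr => j _ do rewrite ceM.
case: leqP => iM.
  rewrite (bigD1_seq i) ?iota_uniq ?mem_index_iota //= eqxx big1 ?addr0 // => j ji.
  by rewrite (negPf ji).
apply: big1_seq => j /=; rewrite mem_index_iota => /andP[_ jM].
by rewrite (ltn_eqF (leq_trans jM iM)).
Qed.

Lemma ce_cesE M i : cam (ce C i) (ces C 0 M) = if (i <= M)%N then ce C i else 0.
Proof.
rewrite cam_sumr; under eq_bigr => j _ do rewrite ceM.
case: leqP => iM.
  rewrite (bigD1_seq i) ?iota_uniq ?mem_index_iota //= eqxx big1 ?addr0 // => j ji.
  by rewrite eq_sym (negPf ji).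
apply: big1_seq => j /=; rewrite mem_index_iota => /andP[_ jM].
by rewrite (gtn_eqF (leq_trans jM iM)).
Qed.

Lemma ces_cesl M N : (M <= N)%N -> cam (ces C 0 N) (ces C 0 M) = ces C 0 M.
Proof.
move=> MN; rewrite {2}/ces cam_sumr; apply: eq_big_seq => i.
by rewrite mem_index_iota ltnS => /andP[_ iM]; rewrite ces_ceE (leq_trans iM MN).
Qed.

Lemma ces_cesr M N : (M <= N)%N -> cam (ces C 0 M) (ces C 0 N) = ces C 0 M.
Proof.
move=> MN; rewrite {1}/ces cam_suml; apply: eq_big_seq => i.
by rewrite mem_index_iota ltnS => /andP[_ iM]; rewrite ce_cesE (leq_trans iM MN).
Qed.

(** Only finitely many coefficients of [a] are nonzero, so [M] can bound the targets of all of them.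
    Such local units stand in for a unit of the algebra. *)
Lemma ces_id (a : A) : exists M, cam (ces C 0 M) a = a.
Proof.
have /finite_seqP[s es] := ca_finite a.
have [M bM] : exists M, forall p, p \in s -> (p.2 <= M)%N.
  by exists (\max_(p <- s) p.2) => p ps; exact: (leq_bigmax_seq p).
exists M; apply: catalgP => m n; rewrite cam_suml ca_sumE.
under eq_bigr => i _ do rewrite cam_ceE eq_sym.
have [-> | nz] := eqVneq (a m n) 0; first by rewrite big1 // => i _; case: ifP.
have nM : (n <= M)%N by apply: (bM (m, n)); have : [set` s] (m, n) by rewrite -es.
rewrite (bigD1_seq n) ?iota_uniq ?mem_index_iota //= eqxx big1 ?addr0 // => i ni.
by rewrite (negPf ni).
Qed.

End Idempotents.

(** * Gradedness as the existence of local units *)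

Section Graded.
Variables (R : comPzRingType) (C : lincat R) (V : amod C).
Local Notation e := (ces C 0).

Lemma am_act0l (v : V) : am_act 0 v = 0.
Proof. by have := am_actZl 0 0 v; rewrite !scale0r. Qed.

Lemma am_act_suml I (r : seq I) (P : pred I) (F : I -> catalg C) (v : V) :
  am_act (\sum_(i <- r | P i) F i) v = \sum_(i <- r | P i) am_act (F i) v.
Proof. by elim/big_rec2: _ => [|i x y _ <-]; rewrite ?am_act0l ?am_actDl. Qed.

Lemma am_act_sumr I (r : seq I) (P : pred I) a (F : I -> V) :
  am_act a (\sum_(i <- r | P i) F i) = \sum_(i <- r | P i) am_act a (F i).
Proof. by elim/big_rec2: _ => [|i x y _ <-]; rewrite ?am_act0r ?am_actDr. Qed.

Lemma ces_act_le M N (v : V) :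
  (M <= N)%N -> am_act (e M) v = v -> am_act (e N) v = v.
Proof. by move=> MN <-; rewrite am_actA ces_cesl. Qed.

(** By [ces_act_le] the bounds of the single elements can be replaced by their maximum. This
    supplies one bound for all generators, and later one for all relations. *)
Lemma ces_act_seq (s : seq V) :
    (forall v, v \in s -> exists M, am_act (e M) v = v) ->
  exists M, forall v, v \in s -> am_act (e M) v = v.
Proof.
elim: s => [|v s IHs] hs; first by exists 0%N.
have [M1 e1] : exists M, am_act (e M) v = v by apply: hs; rewrite mem_head.
have [M2 e2] := IHs (fun u us => hs u (mem_behead (s := v :: s) us)).
exists (maxn M1 M2) => u; rewrite inE => /predU1P[->|/e2].
  exact: ces_act_le (leq_maxl _ _) e1.
exact/ces_act_le/leq_maxr.
Qed.

Lemma fsbig_nat_lt (w : nat -> V) M : (forall n, (M < n)%N -> w n = 0) ->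
  \sum_(n \in [set: nat]) w n = \sum_(0 <= n < M.+1) w n.
Proof.
move=> wM; rewrite (fsbigE (index_iota 0 M.+1)) ?iota_uniq //.
  by apply: eq_bigl => i; rewrite in_setT.
by move=> i _; rewrite mem_index_iota -leqNgt => /wM.
Qed.

Lemma finite_support_bound (w : nat -> V) : finite_set [set n | w n != 0] ->
  exists M, forall n, (M < n)%N -> w n = 0.
Proof.
move=> /finite_seqP[s es]; exists (\max_(n <- s) n) => n.
have [//|nz] := eqVneq (w n) 0.
have ns : n \in s by have : [set` s] n by rewrite -es.
by rewrite ltnNge (leq_bigmax_seq n).
Qed.

(** A bound for the support of the homogeneous decomposition serves as [M]. Conversely, a vector [v]
    fixed by [e M] is the sum of its components [am_act (ce C n) v] with n <= M. *)
Lemma amod_gradedP : amod_graded V <-> forall v : V, exists M, am_act (e M) v = v.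
Proof.
split=> [gr v|loc v].
  have [w [[wr wf vE] _]] := gr v; have [M wM] := finite_support_bound wf.
  exists M; rewrite vE (fsbig_nat_lt wM) am_act_sumr; apply: eq_big_seq => n.
  rewrite mem_index_iota ltnS => /andP[_ nM].
  by have [u _ <-] := wr n; rewrite am_actA ces_ceE nM.
have [M eM] := loc v.
(* For n > M the product of [ce C n] with [e M] vanishes. *)
have v0 n : (M < n)%N -> am_act (ce C n) v = 0.
  by move=> Mn; rewrite -eM am_actA ce_cesE leqNgt Mn am_act0l.
exists (fun n => am_act (ce C n) v); split.
  split=> [n||]; first by exists v.
    apply: (sub_finite_set _ (finite_II M.+1)) => n /=; rewrite ltnS leqNgt.
    by apply: contra_neqN => /v0.
  by rewrite (fsbig_nat_lt v0) -am_act_suml eM.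
(* Uniqueness: [ce C n] applied to the sum of the [w i] leaves only [w n], by orthogonality of the
   idempotents. *)
move=> w [wr wf vE]; apply/funext => n; have [M' wM] := finite_support_bound wf.
rewrite vE (fsbig_nat_lt wM) am_act_sumr.
have wE i : am_act (ce C n) (w i) = if n == i then w n else 0.
  have [<-|ni] := eqVneq n i; first by have [u _ <-] := wr n; rewrite am_actA ceM eqxx.
  by have [u _ <-] := wr i; rewrite am_actA ceM (negPf ni) am_act0l.
under eq_bigr => i _ do rewrite wE.
case: (leqP n M') => nM; last first.
  by rewrite (wM n) // big1 // => i _; case: ifP.
rewrite (bigD1_seq n) ?iota_uniq ?mem_index_iota //= eqxx big1 ?addr0 // => i ni.
by rewrite eq_sym (negPf ni).
Qed.

End Graded.

(** * The graded, finitely generated module (A e)^k *)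

Section FreeModule.
Variables (R : comPzRingType) (C : lincat R) (k N : nat).
Local Notation A := (catalg C).
Local Notation e := (ces C 0 N).

Definition free_pred : {pred {ffun 'I_k -> A}} :=
  fun y => `[< forall i, cam (y i) e = y i >].

Lemma free_predP (y : {ffun 'I_k -> A}) : reflect (forall i, cam (y i) e = y i) (y \in free_pred).
Proof. exact: asboolP. Qed.

Fact free_submod : submod_closed free_pred.
Proof.
split=> [|r x y /free_predP xe /free_predP ye]; apply/free_predP => i.
  by rewrite ffunE cam0l.
by rewrite !ffunE camDl camZl xe ye.
Qed.
HB.instance Definition _ := GRing.isSubmodClosed.Build R _ free_pred free_submod.

(* The projective module (A e)^k. *)
Record free := Free { free_val : {ffun 'I_k -> A}; _ : free_val \in free_pred }.
HB.instance Definition _ := [isSub for free_val].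
HB.instance Definition _ := [Choice of free by <:].
HB.instance Definition _ := [SubChoice_isSubLmodule of free by <:].

Lemma freeP (y : free) i : cam (free_val y i) e = free_val y i.
Proof. by case: y => y /= /free_predP. Qed.

Lemma free_ext (x y : free) :
  (forall i, free_val x i = free_val y i) -> x = y.
Proof. by move=> xy; apply/val_inj/ffunP. Qed.

Fact free_act_in a (y : free) : [ffun i => cam a (free_val y i)] \in free_pred.
Proof. by apply/free_predP => i; rewrite ffunE -camA freeP. Qed.
Definition free_act a y := Free (free_act_in a y).

Lemma free_actE a y i : free_val (free_act a y) i = cam a (free_val y i).
Proof. by rewrite /= ffunE. Qed.

Lemma free_addE (x y : free) i :
  free_val (x + y) i = free_val x i + free_val y i.
Proof. by rewrite -[free_val (x + y)]/(free_val x + free_val y) ffunE. Qed.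

Lemma free_scaleE r (y : free) i : free_val (r *: y) i = r *: free_val y i.
Proof. by rewrite -[free_val (r *: y)]/(r *: free_val y) ffunE. Qed.

Lemma free_0E i : free_val 0 i = 0.
Proof. by rewrite -[free_val 0]/(0 : {ffun 'I_k -> A}) ffunE. Qed.

Lemma free_sumE I (r : seq I) (P : pred I) (F : I -> free) i :
  free_val (\sum_(j <- r | P j) F j) i = \sum_(j <- r | P j) free_val (F j) i.
Proof.
by elim/big_rec2: _ => [|j x y _ <-]; rewrite ?free_0E ?free_addE.
Qed.

Fact free_actDl a b y : free_act (a + b) y = free_act a y + free_act b y.
Proof. by apply: free_ext => i; rewrite free_addE !free_actE camDl. Qed.
Fact free_actDr a x y : free_act a (x + y) = free_act a x + free_act a y.
Proof. by apply: free_ext => i; rewrite !(free_addE, free_actE) camDr. Qed.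
Fact free_actZl r a y : free_act (r *: a) y = r *: free_act a y.
Proof. by apply: free_ext => i; rewrite free_scaleE !free_actE camZl. Qed.
Fact free_actZr r a y : free_act a (r *: y) = r *: free_act a y.
Proof. by apply: free_ext => i; rewrite !(free_scaleE, free_actE) camZr. Qed.
Fact free_actA a b y : free_act a (free_act b y) = free_act (cam a b) y.
Proof. by apply: free_ext => i; rewrite !free_actE camA. Qed.

Definition free_amod : amod C :=
  AMod free_actDl free_actDr free_actZl free_actZr free_actA.

(** Each of the finitely many entries has a left local unit, and the one of largest index works for
    all of them. *)
Lemma free_graded : amod_graded free_amod.
Proof.
apply/amod_gradedP => y.
have [M bM] : exists M, forall i, cam (ces C 0 M) (free_val y i) = free_val y i.
  have /choice[f fE] i := ces_id (free_val y i).
  exists (\max_i f i) => i; rewrite -fE camA ces_cesl //.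
  exact: (leq_bigmax_cond (F := f) i).
by exists M; apply: free_ext => i; rewrite -[RHS]bM; exact: free_actE.
Qed.

(** The standard basis vectors carry [e] in place of 1; they generate because y_j e = y_j for every
    entry of an element y. *)
Fact free_gen_in (j : 'I_k) : [ffun i => if i == j then e else 0] \in free_pred.
Proof.
by apply/free_predP => i; rewrite ffunE; case: ifP; rewrite ?ces_idem ?cam0l.
Qed.
Definition free_gen j := Free (free_gen_in j).

Lemma free_genE j i : free_val (free_gen j) i = if i == j then e else 0.
Proof. by rewrite /= ffunE. Qed.

Lemma free_decomp (y : free) :
  y = \sum_j free_act (free_val y j) (free_gen j).
Proof.
apply: free_ext => i; rewrite free_sumE (bigD1 i) // big1 ?Monoid.mulm1 => [|j ji].
  by rewrite free_actE free_genE eqxx freeP.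
by rewrite free_actE free_genE eq_sym (negPf ji) cam0r.
Qed.

Lemma free_fg : amod_fg free_amod.
Proof.
exists [seq free_gen j | j <- enum 'I_k]; apply/seteqP; split=> // y _ S [subS genS].
rewrite [y]free_decomp; apply: (big_ind S); [exact: (ams_0 subS) | exact: (ams_D subS) |].
move=> j _; apply: (ams_act subS); apply: genS => /=.
by apply/map_f/mem_enum.
Qed.

End FreeModule.

(** * The counit Ae (x)_(eAe) eV -> V *)

Section Counit.
Variables (R : comPzRingType) (C : lincat R) (V : amod C) (N : nat).
Local Notation e := (ces C 0 N).

Let pairing (x : leftid C N) (v : cornermod N V) : V :=
  am_act (leftid_val x) (cornermod_val v).

Definition counit (t : central N V) : V := \sum_(p <- repr t) pairing p.1 p.2.

(** The action pairing is biadditive and balanced over eAe, so the sum does not depend on the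
    representative chosen in [counit]. *)
Lemma counit_pi s :
  counit (\pi_(tensor (leftid C N) (cornermod N V))%qT s) = \sum_(p <- s) pairing p.1 p.2.
Proof.
apply: (@tensor_rel_sum _ _ _ _ pairing) (tensor_reprP _) => [x y v|x u v|b x v].
- exact: am_actDl.
- exact: am_actDr.
- by rewrite /pairing /= am_actA.
Qed.

Lemma counitD : {morph counit : s t / s + t}.
Proof.
move=> s t; rewrite -[s]reprK -[t]reprK [X in counit X]tadd_pi !counit_pi.
by rewrite big_cat.
Qed.

Lemma counit_pure x v :
  counit (tpure x v) = am_act (leftid_val x) (cornermod_val v).
Proof. by rewrite counit_pi big_seq1. Qed.

Lemma counit_act a t : counit (central_act a t) = am_act a (counit t).
Proof.
apply: (tensor_ext (g := fun t => counit (central_act a t))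
                   (h := fun t => am_act a (counit t))) => [s u|s u|x v] /=.
- by rewrite central_actDr counitD.
- by rewrite counitD am_actDr.
- by rewrite central_act_pure !counit_pure am_actA.
Qed.

Lemma counit_scalable : scalable counit.
Proof.
move=> r t.
apply: (tensor_ext (g := fun t => counit (centralZ r t))
                   (h := fun t => r *: counit t)) => [s u|s u|x v] /=.
- by rewrite centralZDr counitD.
- by rewrite counitD scalerDr.
- by rewrite centralZ_pure !counit_pure -am_actZl.
Qed.

Lemma counit_iso :
  (forall t, counit t = 0 -> t = 0) -> (forall v, exists t, counit t = v) ->
  amod_iso (central_amod N V) V.
Proof.
move=> inj surj.
have counitL : linear counit by move=> r s t; rewrite counitD counit_scalable.
pose f : {linear central N V -> V} := HB.pack counit
  (GRing.isLinear.Build R (central N V) V *:%R counit counitL).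
exists f; split; last exact: counit_act.
(* The inverse picks preimages; that it is also a left inverse follows from the trivial kernel,
   applied to the difference of [g (counit t)] and [t]. *)
have /choice[g gK] := surj; exists g => // t.
apply/eqP; rewrite -subr_eq0; apply/eqP/inj.
by apply: (etrans (raddfB f _ _)); rewrite /= gK subrr.
Qed.

End Counit.

(** * The map from (A e_{0,N0})^k to V given by k elements of V *)

Section Presentation.
Variables (R : comPzRingType) (C : lincat R) (V : amod C).
Variables (k N0 : nat) (s : 'I_k -> V).
Local Notation F := (free C k N0).

Definition free_lift (y : F) : V := \sum_i am_act (free_val y i) (s i).

Lemma free_liftD x y : free_lift (x + y) = free_lift x + free_lift y.
Proof.
by rewrite -big_split; apply: eq_bigr => i _; rewrite free_addE am_actDl.
Qed.

Lemma free_liftZ r y : free_lift (r *: y) = r *: free_lift y.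
Proof.
by rewrite scaler_sumr; apply: eq_bigr => i _; rewrite free_scaleE am_actZl.
Qed.

Lemma free_lift_act a y : free_lift (free_act a y) = am_act a (free_lift y).
Proof.
by rewrite am_act_sumr; apply: eq_bigr => i _; rewrite free_actE am_actA.
Qed.

Lemma free_lift0 : free_lift 0 = 0.
Proof. by have := free_liftZ 0 0; rewrite !scale0r. Qed.

Lemma free_lift_ker : @amod_submodule R C (free_amod C k N0) [set y | free_lift y = 0].
Proof.
split=> [|x y /= x0 y0|r y /= y0|a y /= y0].
- exact: free_lift0.
- by rewrite free_liftD x0 y0 addr0.
- by rewrite free_liftZ y0 scaler0.
- by rewrite free_lift_act y0 am_act0r.
Qed.

Hypothesis sE : forall i, am_act (ces C 0 N0) (s i) = s i.

Lemma free_lift_gen i : free_lift (free_gen C N0 i) = s i.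
Proof.
rewrite /free_lift (bigD1 i) // big1 ?Monoid.mulm1 => [|j ji].
  by rewrite free_genE eqxx sE.
by rewrite free_genE (negPf ji) am_act0l.
Qed.

(** The image is a submodule, and it contains each [s i] as the image of a basis vector. *)
Lemma free_lift_surj :
  [set: V] = smallest (@amod_submodule R C V) (range s) ->
  forall v, exists y, free_lift y = v.
Proof.
move=> gen v; have : [set: V] v by [].
rewrite gen => /(_ (range free_lift)) [|y _ <-]; last by exists y.
split=> [|_ [i _ <-]]; last by exists (free_gen C N0 i); rewrite ?free_lift_gen.
split=> [|_ _ [x _ <-] [y _ <-]|r _ [y _ <-]|a _ [y _ <-]].
- by exists 0; rewrite ?free_lift0.
- by exists (x + y); rewrite ?free_liftD.
- by exists (r *: y); rewrite ?free_liftZ.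
- by exists (free_act a y); rewrite ?free_lift_act.
Qed.

(** * Lifting the presentation through the counit *)

Variable N : nat.
Hypothesis N0N : (N0 <= N)%N.
Local Notation e := (ces C 0 N).

(** Since N0 <= N, the left ideal A e_{0,N0} is contained in A e_{0,N}. *)
Fact free_leftid_in (y : F) i : free_val y i \in leftid_pred N.
Proof. by apply/leftid_predP; rewrite -freeP -camA ces_cesr. Qed.
Let yl y i := LeftId (free_leftid_in y i).

Fact gen_cornermod_in i : s i \in @cornermod_pred R C N V.
Proof. by apply/cornermod_predP; exact: ces_act_le (sE i). Qed.
Let sc i := CornerMod (gen_cornermod_in i).

Definition free_tensor (y : F) : central N V := \sum_i tpure (yl y i) (sc i).

Lemma free_tensorD x y : free_tensor (x + y) = free_tensor x + free_tensor y.
Proof.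
rewrite -big_split; apply: eq_bigr => i _; rewrite -[RHS]tpureDl; congr tpure.
by apply: val_inj; exact: free_addE.
Qed.

Lemma free_tensorZ r y : free_tensor (r *: y) = r *: free_tensor y.
Proof.
rewrite scaler_sumr; apply: eq_bigr => i _.
rewrite -[RHS]/(centralZ r _) centralZ_pure; congr tpure.
by apply: val_inj; exact: free_scaleE.
Qed.

Lemma central_act0 a : central_act a (0 : central N V) = 0.
Proof. exact: (@am_act0r _ _ (central_amod N V)). Qed.

Lemma free_tensor_act a y : free_tensor (free_act a y) = central_act a (free_tensor y).
Proof.
rewrite [RHS](@am_act_sumr _ _ (central_amod N V)); apply: eq_bigr => i _.
rewrite [RHS]central_act_pure; congr tpure.
by apply: val_inj; exact: free_actE.
Qed.

Lemma counit_free_tensor y : counit (free_tensor y) = free_lift y.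
Proof.
have c0 : counit (0 : central N V) = 0.
  by apply: (addrI (counit (0 : central N V))); rewrite -counitD !addr0.
rewrite (big_morph _ (@counitD _ _ _ _) c0); apply: eq_bigr => i _.
exact: counit_pure.
Qed.

(** Write v = e v as the sum of the (e y_i) s_i. The coefficients e y_i lie in eAe, so they cross
    the tensor sign, and x e y_i = x y_i because x lies in Ae. *)
Lemma tpure_free_tensor (x : leftid C N) (v : cornermod N V) y :
  cornermod_val v = free_lift y ->
  tpure x v = free_tensor (free_act (leftid_val x) y).
Proof.
move=> vy.
(* On the right, [e] fixes the product because y_i already lies in A e. *)
have in_corner i : cam e (free_val y i) \in corner_pred N.
  apply/corner_predP; rewrite camA ces_idem -camA; split=> //; congr cam.
  exact/leftid_predP/free_leftid_in.
have -> : v = \sum_i Corner (in_corner i) *: sc i.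
  apply: val_inj; rewrite raddf_sum /=.
  rewrite -(elimT (cornermod_predP _ _) (valP v)) [val v]vy am_act_sumr.
  by apply: eq_bigr => i _; rewrite am_actA.
have t0 : tpure x (0 : cornermod N V) = 0.
  by apply: (addrI (tpure x 0)); rewrite -tpureDr !addr0.
rewrite (big_morph _ (tpureDr x) t0); apply: eq_bigr => i _.
rewrite -tpure_bal; congr tpure; apply: val_inj => /=.
by rewrite ffunE camA (elimT (leftid_predP _ _) (valP x)).
Qed.

Lemma free_tensor_surj :
  (forall v, exists y, free_lift y = v) -> forall t, exists y, free_tensor y = t.
Proof.
move=> surj t; have [r ->] := tensor_sum t.
elim: r => [|[x v] r [z zE]].
  (* Zero is written as a scalar multiple so that [free_tensorZ] shows its image to be zero. *)
  by exists (0 *: 0); rewrite free_tensorZ scale0r big_nil.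
have [y yE] := surj (cornermod_val v).
exists (free_act (leftid_val x) y + z).
by rewrite big_cons free_tensorD zE /= (tpure_free_tensor x (esym yE)).
Qed.

(** The kernel of [free_tensor] is a submodule, so it suffices that it contains the generators [r]
    of the kernel of [free_lift]. *)
Lemma free_tensor_ker (r : seq F) :
    [set y | free_lift y = 0] =
      smallest (@amod_submodule R C (free_amod C k N0)) [set` r] ->
    (forall y, y \in r -> free_act e y = y) ->
  forall y, free_lift y = 0 -> free_tensor y = 0.
Proof.
move=> genK rE y y0; have : [set y | free_lift y = 0] y by [].
rewrite genK => /(_ [set y | free_tensor y = 0]); apply; split.
  split=> [|u v /= u0 v0|c u /= u0|a u /= u0].
  - by rewrite /= -(scale0r 0) free_tensorZ scale0r.
  - by rewrite free_tensorD u0 v0 addr0.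
  - by rewrite free_tensorZ u0 scaler0.
  - by rewrite free_tensor_act u0 central_act0.
move=> z /= zr.
have z0 : free_lift z = 0.
  by have : [set y | free_lift y = 0] z by rewrite genK => S [_]; apply.
have e_in : e \in leftid_pred N by apply/leftid_predP; exact: ces_idem.
(* As z = e z and [free_lift z] is 0, [tpure_free_tensor] with x = e and v = 0 identifies
   [free_tensor z] with e (x) 0. *)
rewrite -(rE z zr) -(@tpure_free_tensor (LeftId e_in) 0) //.
by apply: (addrI (tpure (LeftId e_in) 0)); rewrite -tpureDr !addr0.
Qed.

End Presentation.

(** * Central stability from finitely many generators and relations *)

Theorem corollary3p3 (R : comPzRingType) (C : lincat R) :
  (forall V : amod C, amod_graded V -> amod_fg V -> amod_noetherian V) ->
  (forall V : amod C, amod_graded V -> amod_fg V -> centrally_stable V).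
Proof.
move=> noeth V /amod_gradedP grV [s genV].
have [N0 sE] : exists M, forall v, v \in s -> am_act (ces C 0 M) v = v.
  by apply: ces_act_seq => v _; exact: grV.
pose g (i : 'I_(size s)) := tnth (in_tuple s) i.
have gE i : am_act (ces C 0 N0) (g i) = g i by apply/sE/mem_tnth.
have genVg : [set: V] = smallest (@amod_submodule R C V) (range g).
  rewrite genV; congr smallest; apply/seteqP; split=> v /=.
    by move=> /(tnthP (in_tuple s))[i ->]; exists i.
  by case=> i _ <-; exact: mem_tnth.
have surj := free_lift_surj gE genVg.
(* The noetherian hypothesis is applied to the free-type module rather than to [V]: [r] generates
   the relations among the [g i]. *)
have [r genK] := noeth _ (@free_graded R C (size s) N0)
  (@free_fg R C (size s) N0) _ (free_lift_ker N0 g).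
have [N1 rE] : exists M, forall y, y \in r -> free_act (ces C 0 M) y = y.
  apply: (@ces_act_seq R C (free_amod C (size s) N0)) => y _.
  by move/amod_gradedP: (@free_graded R C (size s) N0); apply.
(* Beyond [N0] the idempotent fixes the generators, beyond [N1] also the relations. *)
exists (maxn N0 N1) => N; rewrite geq_max => /andP[N0N N1N].
have rEN y : y \in r -> free_act (ces C 0 N) y = y.
  move=> /rE; exact: (@ces_act_le R C (free_amod C (size s) N0)).
apply: counit_iso => [t|v].
  (* Injectivity: every tensor is [free_tensor y], so a zero counit makes y a relation. *)
  have [y <-] := free_tensor_surj gE N0N surj t.
  by rewrite counit_free_tensor; exact: free_tensor_ker genK rEN y.
have [y <-] := surj v.
by exists (free_tensor gE N0N y); rewrite counit_free_tensor.
Qed.
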